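(* Suppose that: (i) for each $(\pi,V)\in\mathbb{S}\times\mathbb{R}^d$ there exists a unique Nash minimizer $P(\pi,V)$ of $e(\pi,\cdot,V)$; (ii) each cost $c_{ij}(\pi,P)=c_{ij}(\pi,P_{i\cdot})$ depends only on $\pi$ and on the $i$-th row $P_{i\cdot}$ of $P$; (iii) for any $\pi\in\mathbb{S}$ and all $V^1,V^2\in\mathbb{R}^d$: for any $i\in\operatorname{argmax}(V^1-V^2)$ one has $\mathcal{G}_\pi(V^1)_i-V^1_i\le\mathcal{G}_\pi(V^2)_i-V^2_i$, and the opposite inequality holds for any $i\in\operatorname{argmin}(V^1-V^2)$. Let $\pi\in\mathbb{S}$, and let $\lambda^k\in\mathbb{R}$ and $V^k\in\mathbb{R}^d$, $k=1,2$, be solutions of $$\mathcal{G}_\pi(V^k)=\lambda^k+V^k.$$ Then $\lambda^1=\lambda^2$.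
   Context: Let $d>1$ be an integer and $\mathbb{S}=\{(q_1,\dots,q_d): q_j\ge 0\ \forall j,\ \sum_{j=1}^d q_j=1\}$. The set of $d\times d$ (row-)stochastic (transition) matrices is identified with $\mathbb{S}^d$. Given transition costs $c_{ij}(\pi,P)$, $1\le i,j\le d$ (functions of $\pi\in\mathbb{S}$, $P\in\mathbb{S}^d$), define $e_i(\pi,P,V)=\sum_j \left(c_{ij}(\pi,P)P_{ij}+V_jP_{ij}\right)$ for $V\in\mathbb{R}^d$. For $P\in\mathbb{S}^d$, $q\in\mathbb{S}$, $\mathcal{P}(P,q,i)$ is the stochastic matrix obtained from $P$ by replacing its $i$-th row by $q$. A matrix $P\in\mathbb{S}^d$ is a Nash minimizer of $e(\pi,\cdot,V)$ if for each $i$ and any $q\in\mathbb{S}$, $e_i(\pi,P,V)\le e_i(\pi,\mathcal{P}(P,q,i),V)$. When a unique Nash minimizer $P(\pi,V)$ exists for all $(\pi,V)$, define $\mathcal{G}_\pi(V)_i=e_i(\pi,P(\pi,V),V)$. Adding a scalar to a vector means adding it to every component. For $W\in\mathbb{R}^d$, $\operatorname{argmax}W$ (resp. $\operatorname{argmin}W$) is the set of indices $i$ at which $W_i$ is maximal (resp. minimal). *)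

(* Defs.v *)
From mathcomp Require Import all_boot all_order all_algebra.
From mathcomp Require Import boolp classical_sets reals.

Set Implicit Arguments.
Unset Strict Implicit.
Unset Printing Implicit Defensive.

Import Order.TTheory GRing.Theory Num.Theory.
Local Open Scope ring_scope.

(* Elements of the simplex, rows of stochastic matrices and value vectors are
   all row vectors 'rV[R]_d. *)

Definition simplex (R : realType) (d : nat) (q : 'rV[R]_d) : Prop :=
  (forall j, 0 <= q 0 j) /\ \sum_(j < d) q 0 j = 1.

Definition stochastic (R : realType) (d : nat) (P : 'M[R]_d) : Prop :=
  forall i, simplex (row i P).

(* Costs are total functions; only their values at a pi in the simplex and a
   stochastic P are meaningful, and hypotheses must be restricted to those. *)
Definition costs (R : realType) (d : nat) : Type :=
  'I_d -> 'I_d -> 'rV[R]_d -> 'M[R]_d -> R.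

Definition expected_cost (R : realType) (d : nat) (c : costs R d) (i : 'I_d)
    (pi : 'rV[R]_d) (P : 'M[R]_d) (V : 'rV[R]_d) : R :=
  \sum_(j < d) (c i j pi P * P i j + V 0 j * P i j).

Definition replace_row (R : realType) (d : nat) (P : 'M[R]_d) (q : 'rV[R]_d)
    (i : 'I_d) : 'M[R]_d :=
  \matrix_(k, j) (if k == i then q 0 j else P k j).

Definition nash_minimizer (R : realType) (d : nat) (c : costs R d)
    (pi V : 'rV[R]_d) (P : 'M[R]_d) : Prop :=
  stochastic P /\
  forall (i : 'I_d) (q : 'rV[R]_d), simplex q ->
    expected_cost c i pi P V <= expected_cost c i pi (replace_row P q i) V.

(* The Nash minimizer P(pi, V) when a unique one exists; an arbitrarily chosen
   Nash minimizer, or 0 if there is none, otherwise. *)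
Definition the_nash_minimizer (R : realType) (d : nat) (c : costs R d)
    (pi V : 'rV[R]_d) : 'M[R]_d :=
  xget 0 [set P | nash_minimizer c pi V P]%classic.

Definition calG (R : realType) (d : nat) (c : costs R d)
    (pi V : 'rV[R]_d) : 'rV[R]_d :=
  \row_i expected_cost c i pi (the_nash_minimizer c pi V) V.

Definition argmax_set (R : realType) (d : nat) (W : 'rV[R]_d) : {set 'I_d} :=
  [set i | [forall j, W 0 j <= W 0 i]].

Definition argmin_set (R : realType) (d : nat) (W : 'rV[R]_d) : {set 'I_d} :=
  [set i | [forall j, W 0 i <= W 0 j]].

(* Main.v *)
Require Import Defs.
From mathcomp Require Import all_boot all_order all_algebra.
From mathcomp Require Import boolp classical_sets reals.

Set Implicit Arguments.
Unset Strict Implicit.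
Unset Printing Implicit Defensive.

Import Order.TTheory GRing.Theory Num.Theory.
Local Open Scope ring_scope.

(** Each equation says that [calG c pi Vk - Vk] is the constant vector [lambdak], so comparing the
    two at a single index compares the two scalars. [V1 - V2] has finitely many entries, hence
    attains its maximum and its minimum; [h_cmp] at a maximizer and at a minimizer gives the two
    opposite inequalities. *)

Theorem proposition8 (R : realType) (d : nat) (hd : (1 < d)%N) (c : costs R d)
  (h_nash : forall pi V : 'rV[R]_d, simplex pi ->
     exists! P : 'M[R]_d, nash_minimizer c pi V P)
  (h_row : forall (i j : 'I_d) (pi : 'rV[R]_d) (P Q : 'M[R]_d),
     simplex pi -> stochastic P -> stochastic Q ->
     row i P = row i Q -> c i j pi P = c i j pi Q)
  (h_cmp : forall pi V1 V2 : 'rV[R]_d, simplex pi ->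
     (forall i, i \in argmax_set (V1 - V2) ->
        calG c pi V1 0 i - V1 0 i <= calG c pi V2 0 i - V2 0 i) /\
     (forall i, i \in argmin_set (V1 - V2) ->
        calG c pi V2 0 i - V2 0 i <= calG c pi V1 0 i - V1 0 i))
  (pi : 'rV[R]_d) (hpi : simplex pi)
  (lambda1 lambda2 : R) (V1 V2 : 'rV[R]_d)
  (hV1 : calG c pi V1 = const_mx lambda1 + V1)
  (hV2 : calG c pi V2 = const_mx lambda2 + V2) :
  lambda1 = lambda2.
Proof.
have calG_subE k : (calG c pi V1 0 k - V1 0 k = lambda1) *
    (calG c pi V2 0 k - V2 0 k = lambda2).
  by rewrite hV1 hV2 !mxE !addrK.
have [le_max le_min] := h_cmp pi V1 V2 hpi.
(* Index 0 exists since [0 < d]; it witnesses that the index set is nonempty, as [arg_maxP] and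
   [arg_minP] require. *)
pose i0 : 'I_d := Ordinal (ltnW hd).
apply/eqP; rewrite eq_le; apply/andP; split.
  (* A maximizer of [V1 - V2] yields [lambda1 <= lambda2]. *)
  have [i _ i_max] := @arg_maxP _ _ _ i0 predT (fun k => (V1 - V2) 0 k) isT.
  have /le_max : i \in argmax_set (V1 - V2).
    by rewrite inE; apply/forallP => j; apply: i_max.
  by rewrite !calG_subE.
(* A minimizer yields the reverse, [lambda2 <= lambda1]. *)
have [i _ i_min] := @arg_minP _ _ _ i0 predT (fun k => (V1 - V2) 0 k) isT.
have /le_min : i \in argmin_set (V1 - V2).
  by rewrite inE; apply/forallP => j; apply: i_min.
by rewrite !calG_subE.
Qed.
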